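(* Let $X$ be a set and let $C\subseteq\{0,1\}^X$ be a finite concept class with $|C|\ge 2$ and VC-dimension $d$. Then the recursive teaching dimension of $C$ is at most $$d\,2^{d+3}\left(\log(4e^2)+\log\log|C|\right).$$
   Context: A concept class over a set $X$ is a set $C\subseteq\{0,1\}^X$ of functions $X\to\{0,1\}$; its elements are called concepts. A set $Y\subseteq X$ is shattered by $C$ if for every $Z\subseteq Y$ there is $c\in C$ with $c(x)=1$ for all $x\in Z$ and $c(x)=0$ for all $x\in Y\setminus Z$. The VC-dimension of $C$ is the maximum size of a subset of $X$ shattered by $C$. A set $Y\subseteq X$ is a teaching set for $c\in C$ in $C$ if for every $c'\in C$ with $c'\neq c$ we have $c'|_Y\neq c|_Y$. For a nonempty finite class $D\subseteq\{0,1\}^X$ and $c\in D$, let $t(c,D)$ be the minimum size of a teaching set for $c$ in $D$, and let $t_{\min}(D)=\min_{c\in D}t(c,D)$. The recursive teaching dimension of a nonempty finite class $C$ is defined by the following process. Put $C_1=C$. As long as $C_i\neq\emptyset$, let the $i$-th layer be $L_i=\{c\in C_i: t(c,C_i)=t_{\min}(C_i)\}$ and put $C_{i+1}=C_i\setminus L_i$. The recursive teaching dimension of $C$ is the maximum of $t_{\min}(C_i)$ over all $i$ with $C_i\ne\emptyset$. Logarithms are to base $2$; $e$ is the base of the natural logarithm. *)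

(* Defs.v *)
From mathcomp Require Import all_boot all_order all_algebra.
From mathcomp Require Import all_classical all_reals all_analysis.

Set Implicit Arguments.
Unset Strict Implicit.
Unset Printing Implicit Defensive.

Import Order.TTheory GRing.Theory Num.Theory.

Local Open Scope classical_set_scope.
Local Open Scope card_scope.

(* Minimum and maximum of a set of natural numbers. The value is 0 when there
   is no minimum (A empty), resp. no maximum (A empty or unbounded); neither
   case arises below for a nonempty finite class. *)
Definition nat_min (A : set nat) : nat :=
  xget 0%N [set n | A n /\ forall m, A m -> (n <= m)%N].

Definition nat_max (A : set nat) : nat :=
  xget 0%N [set n | A n /\ forall m, A m -> (m <= n)%N].

Section ConceptClass.
Variable X : Type.
Implicit Types (C D : set (X -> bool)) (c : X -> bool) (Y Z : set X).

Definition shattered C Y : Prop :=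
  forall Z, Z `<=` Y ->
    exists c, [/\ C c, forall x, Z x -> c x = true
                     & forall x, (Y `\` Z) x -> c x = false].

(* The second clause also excludes infinite shattered sets, for which the
   VC-dimension would not be a natural number. *)
Definition has_VCdim C (d : nat) : Prop :=
  (exists Y, shattered C Y /\ Y #= `I_d) /\
  (forall Y, shattered C Y -> Y #<= `I_d).

Definition teaching_set D c Y : Prop :=
  forall c', D c' -> c' <> c -> ~ (forall x, Y x -> c' x = c x).

(* Only finite teaching sets compete; in a finite class every concept has one. *)
Definition teach_dim D c : nat :=
  nat_min [set n | exists Y, teaching_set D c Y /\ Y #= `I_n].

Definition teach_dim_min D : nat := nat_min [set teach_dim D c | c in D].

Definition layer D : set (X -> bool) :=
  [set c | D c /\ teach_dim D c = teach_dim_min D].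

(* remaining C i is the class C_(i+1), i.e. C after removal of i layers. *)
Fixpoint remaining C (i : nat) : set (X -> bool) :=
  if i is j.+1 then remaining C j `\` layer (remaining C j) else C.

Definition rec_teach_dim C : nat :=
  nat_max [set teach_dim_min (remaining C i) | i in [set i | remaining C i !=set0]].

End ConceptClass.

Definition log2 (R : realType) (x : R) : R := (ln x / ln 2)%R.

(* Main.v *)
(* Let E = d 2^(d+2) and K = 2 E = d 2^(d+3). Some concept of a class of size
   N >= 2 has a teaching set of size at most
   f(N) = K (log2 (4 e^2) + log2 (log2 N)), by induction on N; since f is
   increasing and the VC-dimension does not grow on subclasses, this bounds
   every layer.
   If log2 N <= f(N), repeated halving gives a teaching set of size log2 N.
   Otherwise two columns almost agree: if any two distinct columns differed in
   at least eps N rows, then O(log m / eps) rows would separate all m columns,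
   and Sauer-Shelah for the dual class, whose VC-dimension is below 2^(d+1),
   together with N <= e m^d, would give N <= (4 / eps)^E. Taking
   eps = 32 N^(-1/E) contradicts this, so fixing two coordinates leaves a
   nonempty class of size at most eps N. That costs two points of the teaching
   set and lowers f by at least 2. The factor (4 / eps)^(2 D) of this elementary
   packing bound for dual VC-dimension D is weaker than Haussler's
   (4 e^2 / eps)^D, but the constants of f leave enough room. *)

Require Import Defs.
From mathcomp Require Import all_boot all_order all_algebra.
From mathcomp Require Import all_classical all_reals all_analysis.
From mathcomp Require Import lra ring zify fintype finset.

Set Implicit Arguments.
Unset Strict Implicit.
Unset Printing Implicit Defensive.

Import Order.TTheory GRing.Theory Num.Theory.

Local Open Scope ring_scope.

(** * Set families: shattering and the Sauer-Shelah bound *)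

Definition shatters (U : finType) (G : {set {set U}}) (S : {set U}) : Prop :=
  forall Z : {set U}, Z \subset S -> exists2 g, g \in G & g :&: S = Z.

Lemma shatters_trace (U : finType) (G : {set {set U}}) (V S : {set U}) :
  S \subset V -> shatters [set g :&: V | g in G] S -> shatters G S.
Proof.
move=> SV sh Z /sh[_ /imsetP[g gG ->] <-]; exists g => //.
by rewrite -setIA (setIidPr SV).
Qed.

(* The bound [x^-D (1 + x)^n] dominates the Sauer-Shelah sum of the binomials
   [C(n, i)], [i <= D], and satisfies the same Pascal recurrence exactly. *)
Lemma sauer_powerset (R : realType) (U : finType) (x : R) :
  0 < x -> x <= 1 -> forall n (V : {set U}) (G : {set {set U}}) (D : nat),
  #|V| = n -> (forall g, g \in G -> g \subset V) ->
  (forall S, shatters G S -> (#|S| <= D)%N) ->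
  #|G|%:R <= x ^- D * (1 + x) ^+ n.
Proof.
move=> x0 x1; have x1' : 1 <= 1 + x by lra.
have xD k : 1 <= x ^- k.
  by rewrite -exprVn exprn_ege1 // invf_ge1.
elim=> [|n IH] V G D cV GV sh.
  rewrite expr0 mulr1; apply: le_trans (xD D).
  rewrite (_ : 1 = 1%:R) // ler_nat.
  have -> : 1%N = #|[set (set0 : {set U})]| by rewrite cards1.
  apply: subset_leq_card; apply/subsetP => g /GV; rewrite inE.
  by move/cards0_eq: cV => ->; rewrite subset0.
have [v vV] : exists v, v \in V by apply/card_gt0P; rewrite cV.
set V' := V :\ v; have cV' : #|V'| = n.
  by move: cV; rewrite (cardsD1 v) vV => -[].
(* [G0] merges the sets of [G] that differ only at [v]; [G1] records each merged pair by its member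
   avoiding [v]. *)
set G0 := [set g :\ v | g in G].
set G1 := [set g in G | (v \notin g) && (v |: g \in G)].
have cG : (#|G| <= #|G0| + #|G1|)%N.
  set Gv := [set g in G | v \in g]; set Gn := [set g in G | v \notin g].
  have -> : #|G| = (#|Gv| + #|Gn|)%N.
    rewrite -(cardsID Gv G); congr (_ + _)%N; apply: eq_card => g.
      by rewrite !inE andbA andbb.
    by rewrite !inE negb_and; case: (g \in G) => //=; rewrite andbT.
  have i1 : {in Gv &, injective (fun g : {set U} => g :\ v)}.
    move=> g h; rewrite !inE => /andP[_ vg] /andP[_ vh] e.
    by rewrite -(setD1K vg) e setD1K.
  rewrite -(card_in_imset i1); set H := [set _ | g in Gv].
  have -> : (#|H| + #|Gn| = #|H :|: Gn| + #|H :&: Gn|)%N by rewrite cardsUI.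
  apply: leq_add; apply: subset_leq_card; apply/subsetP => g.
    rewrite inE => /orP[/imsetP[h]|].
      by rewrite inE => /andP[hG _] ->; apply/imsetP; exists h.
    rewrite inE => /andP[gG vg]; apply/imsetP; exists g => //.
    apply/setP => y; rewrite !inE; case: eqP => [->|//].
    by rewrite (negbTE vg).
  rewrite inE => /andP[/imsetP[h]]; rewrite inE => /andP[hG vh] ->.
  rewrite !inE eqxx /= => /andP[-> _] /=.
  by rewrite setD1K.
have b0 : #|G0|%:R <= x ^- D * (1 + x) ^+ n.
  apply: (IH V') => // [g /imsetP[h hG ->]|S shS].
    by apply: setSD; apply: GV.
  apply: sh => Z ZS.
  have vS : v \notin S.
    have [_ /imsetP[h hG ->] e] := shS S (subxx _).
    by rewrite -e !inE eqxx.
  have [_ /imsetP[h hG ->] e] := shS Z ZS.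
  exists h => //; rewrite -e; apply/setP => y; rewrite !inE.
  by case: (eqVneq y v) => [->|]; rewrite ?(negbTE vS) ?andbF.
(* Each member of [G1] can be extended by [v] inside [G], so [G] shatters [v |: S] as soon as [G1]
   shatters [S]. *)
have sh1 S : shatters G1 S -> (#|S| < D)%N.
  move=> shS.
  have vS : v \notin S.
    have [h hG e] := shS S (subxx _).
    rewrite -e inE negb_and; move: hG; rewrite inE => /and3P[_ -> _] //.
  have -> : #|S|.+1 = #|v |: S| by rewrite cardsU1 vS.
  apply: sh => Z ZS.
  have [|g gG e] := shS (Z :\ v).
    by rewrite subDset.
  move: gG; rewrite inE => /and3P[gG vg vgG].
  have [vZ|vZ] := boolP (v \in Z); [exists (v |: g) => //|exists g => //];
    apply/setP => y; move/setP/(_ y): e; rewrite !inE.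
    by case: (eqVneq y v) => [->|].
  by case: (eqVneq y v) => [->|]; rewrite ?(negbTE vg) ?(negbTE vZ).
have b1 : #|G1|%:R <= x ^- D * (1 + x) ^+ n * x.
  (* For [D = 0] the family [G1] is empty: any member would shatter [set0], against [sh1]. *)
  case: D sh b0 sh1 => [|D] sh b0 sh1.
    rewrite (_ : G1 = set0) ?cards0; first by
      rewrite !mulr_ge0 ?invr_ge0 ?exprn_ge0 //; lra.
    apply/setP => g; rewrite [RHS]inE; apply/negP => gG.
    suff /sh1 : shatters G1 set0 by [].
    by move=> Z; rewrite subset0 => /eqP ->; exists g; rewrite ?setI0.
  rewrite exprSr invfM -!mulrA (mulrC _ x) mulKf ?gt_eqF //.
  apply: (IH V') => // g; rewrite inE => /and3P[gG vg _].
  by rewrite subsetD1 GV.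
apply: le_trans (_ : (#|G0| + #|G1|)%N%:R <= _); first by rewrite ler_nat.
rewrite natrD exprSr (_ : _ * (_ * _) =
  x ^- D * (1 + x) ^+ n + x ^- D * (1 + x) ^+ n * x); last by ring.
exact: lerD.
Qed.

Lemma sauer_trace (R : realType) (U : finType) (x : R) (V : {set U})
    (G : {set {set U}}) (D : nat) :
  0 < x -> x <= 1 ->
  (forall S : {set U}, S \subset V -> shatters G S -> (#|S| <= D)%N) ->
  #|[set g :&: V | g in G]|%:R <= x ^- D * (1 + x) ^+ #|V|.
Proof.
move=> x0 x1 sh; apply: (sauer_powerset x0 x1 (V := V)) => //.
  by move=> _ /imsetP[g _ ->]; rewrite subsetIr.
move=> S shS.
have SV : S \subset V.
  by have [_ /imsetP[g _ ->] <-] := shS S (subxx _); rewrite -setIA setIC -setIA subsetIl.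
exact: sh SV (shatters_trace SV shS).
Qed.

(* A column is encoded by the set of rows in which it has a 1; dually, a row
   [a] becomes the set of the columns containing it. *)
Definition star (T : finType) (a : T) : {set {set T}} := [set B : {set T} | a \in B].

(* Label [2 ^ d.+1] shattered rows by the subsets of ['I_d.+1]: the columns
   realizing the membership patterns of the labels are shattered. *)
Lemma dual_shatters (T : finType) (d : nat) (F : {set {set T}}) (S : {set T}) :
  shatters F S -> (2 ^ d.+1 <= #|S|)%N ->
  exists Y : {set {set T}},
    [/\ Y \subset F, #|Y| = d.+1 & shatters [set star a | a in S] Y].
Proof.
move=> shS cS.
have cJ (J : {set 'I_d.+1}) : (enum_rank J < #|S|)%N.
  apply: leq_trans (ltn_ord _) (leq_trans _ cS).
  by rewrite -cardsT -powersetT card_powerset cardsT card_ord.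
pose phi J : T := enum_val (Ordinal (cJ J)).
have phiS J : phi J \in S by exact: enum_valP.
have phiI : injective phi.
  by move=> J K /enum_val_inj[/val_inj/enum_rank_inj].
have /fin_all_exists2[B BF BE] (i : 'I_d.+1) : exists2 B, B \in F &
    B :&: S = [set phi J | J : {set 'I_d.+1} in [set J : {set 'I_d.+1} | i \in J]].
  by apply: shS; apply/subsetP => _ /imsetP[J _ ->].
have phiB i J : (phi J \in B i) = (i \in J).
  have := BE i => /setP/(_ (phi J)); rewrite inE phiS andbT => ->.
  apply/imsetP/idP => [[K]|iJ]; last by exists J; rewrite ?inE.
  by rewrite inE => iK /phiI ->.
have Binj : injective B.
  move=> i j e; have := phiB j [set i]; rewrite -e phiB !inE eqxx.
  by move/esym/eqP.
exists [set B i | i in 'I_d.+1]; split.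
- by apply/subsetP => _ /imsetP[i _ ->].
- by rewrite card_imset // card_ord.
(* The row labelled by the indices of the columns in [Z] realizes [Z]. *)
move=> Z ZY; exists (star (phi [set i | B i \in Z])).
  exact: imset_f.
apply/setP => b; rewrite !inE; apply/andP/idP => [[h /imsetP[i _ e]]|bZ].
  by move: h; rewrite e phiB inE.
have /imsetP[i _ e] := subsetP ZY _ bZ; split; last by apply/imsetP; exists i.
by rewrite e phiB inE -e.
Qed.

(** * Packing bounds for columns *)

(** Greedy choice: by averaging over [A], some element lies in [hit p] for at least a fraction [eps]
    of the [p] not hit so far, so each new element multiplies their number by at most [1 - eps]. *)
Lemma hitting_set (R : realType) (T I : finType) (A : {set T}) (P : {set I})
    (hit : I -> {set T}) (eps : R) :
  eps <= 1 -> (0 < #|A|)%N ->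
  (forall p, p \in P -> eps * #|A|%:R <= #|hit p :&: A|%:R) ->
  forall k, exists V : {set T}, [/\ V \subset A, (#|V| <= k)%N &
    #|[set p in P | [disjoint hit p & V]]|%:R <= (1 - eps) ^+ k * #|P|%:R].
Proof.
move=> e1 A0 hP; elim=> [|k [V [VA Vk bV]]].
  exists set0; rewrite sub0set cards0; split=> //.
  rewrite expr0 mul1r ler_nat; apply: subset_leq_card.
  by apply/subsetP => p; rewrite inE => /andP[].
set Q := [set p in P | _] in bV.
have [a aA ha] : exists2 a, a \in A & eps * #|Q|%:R <= #|[set p in Q | a \in hit p]|%:R.
  apply: contrapT => no.
  have lt a : a \in A -> #|[set p in Q | a \in hit p]|%:R < eps * #|Q|%:R.
    by move=> aA; rewrite ltNge; apply/negP => h; apply: no; exists a.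
  have /card_gt0P[a0 a0A] := A0.
  have : \sum_(a in A) #|[set p in Q | a \in hit p]|%:R <
      \sum_(a in A) eps * #|Q|%:R.
    apply: ltr_sum => [|a /lt //].
    by apply/hasP; exists a0; rewrite ?mem_index_enum /=.
  apply/negP; rewrite -leNgt sumr_const.
  (* Double counting of the pairs [(a, p)] with [a] in [hit p]. *)
  have -> : \sum_(a in A) #|[set p in Q | a \in hit p]|%:R =
      \sum_(p in Q) #|hit p :&: A|%:R :> R.
    under eq_bigr => a _ do rewrite -sum1_card natr_sum big_mkcond /=.
    rewrite exchange_big /= [RHS]big_mkcond /=; apply: eq_bigr => p _.
    case: ifP => pQ; last first.
      by apply: big1 => a _; rewrite inE pQ.
    rewrite -sum1_card natr_sum [RHS]big_mkcond /= big_mkcond; apply: eq_bigr => a _.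
    by rewrite !inE; move: pQ; rewrite inE => ->; case: (a \in A); rewrite ?andbF ?andbT.
  have -> : (eps * #|Q|%:R) *+ #|A| = (eps * #|A|%:R) *+ #|Q|.
    by rewrite -[LHS]mulr_natr -[RHS]mulr_natr mulrAC.
  rewrite -sumr_const; apply: ler_sum => p; rewrite inE => /andP[pP _].
  exact: hP.
exists (a |: V); split.
- by rewrite subUset sub1set aA.
- by rewrite cardsU1; case: (a \notin V); rewrite ?add1n ?add0n // leqW.
have -> : [set p in P | [disjoint hit p & a |: V]] = Q :\: [set p in Q | a \in hit p].
  apply/setP => p; rewrite !inE -setI_eq0 setIUr setU_eq0 !setI_eq0.
  rewrite (disjoint_sym _ [set a]) disjoints1.
  by case: (p \in P); case: (a \in _); case: [disjoint _ & _].
rewrite cardsD (setIidPr _); last by apply/subsetP => p; rewrite inE => /andP[].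
rewrite natrB; last first.
  by apply: subset_leq_card; apply/subsetP => p; rewrite inE => /andP[].
rewrite exprS -mulrA; apply: le_trans (_ : (1 - eps) * #|Q|%:R <= _); first by lra.
by apply: ler_wpM2l bV; lra.
Qed.

Definition separates (T : finType) (F : {set {set T}}) (A : {set T}) : Prop :=
  {in A &, forall a b, (forall B, B \in F -> (a \in B) = (b \in B)) -> a = b}.

(** Bounds the VC-dimension of the class whose concepts are the rows in [A] and whose points are the
    columns in [F]. *)
Definition row_vc_le (T : finType) (F : {set {set T}}) (A : {set T}) (d : nat) : Prop :=
  forall Y : {set {set T}}, Y \subset F -> shatters [set star a | a in A] Y ->
  (#|Y| <= d)%N.

Lemma shatters_sub (U : finType) (G H : {set {set U}}) (S : {set U}) :
  G \subset H -> shatters G S -> shatters H S.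
Proof. by move=> /subsetP GH sh Z /sh[g /GH gH e]; exists g. Qed.

Lemma row_vc_le_sub (T : finType) (F F' : {set {set T}}) (A A' : {set T}) d :
  F' \subset F -> A' \subset A -> row_vc_le F A d -> row_vc_le F' A' d.
Proof.
move=> FF' AA' vc Y YF' sh; apply: vc (fintype.subset_trans YF' FF') _.
exact: shatters_sub (imsetS _ AA') sh.
Qed.

(** Square [exp(-1/2) >= 1/2]. *)
Lemma expR1_le4 (R : realType) : expR 1 <= 4 :> R.
Proof.
have h : 2^-1 <= expR (- 2^-1) :> R.
  by apply: le_trans (expR_ge1Dx _); lra.
have e : expR 1 * (expR (- 2^-1) * expR (- 2^-1)) = 1 :> R.
  by rewrite -!expRD (_ : _ + _ = 0) ?expR0 //; field.
move: (expR (- 2^-1)) h e => u h e.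
have uu : 4^-1 <= u * u by nra.
have := ler_wpM2l (expR_ge0 (1 : R)) uu; rewrite e; lra.
Qed.

Lemma expr1D_le_expR (R : realType) (x : R) n :
  0 <= x -> (1 + x) ^+ n <= expR (x * n%:R).
Proof.
move=> x0; rewrite expRM_natr; apply: lerXn2r; rewrite ?nnegrE ?expR_ge0 //.
  by lra.
exact: expR_ge1Dx.
Qed.

(** Distinct rows have distinct traces on [F], so Sauer-Shelah applies with [x = 1 / |F|], for which
    [(1 + x)^|F| <= e]. *)
Lemma card_rows_le (R : realType) (T : finType) (F : {set {set T}})
    (A : {set T}) (d : nat) :
  separates F A -> row_vc_le F A d -> (0 < #|F|)%N ->
  #|A|%:R <= expR 1 * #|F|%:R ^+ d :> R.
Proof.
move=> sep vc F0.
have m0 : (0 < #|F|%:R :> R) by rewrite ltr0n.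
have x1 : #|F|%:R^-1 <= 1 :> R by rewrite invf_le1 // ler1n.
have inj : {in A &, injective (fun a => star a :&: F)}.
  move=> a b aA bA e; apply: sep => // B BF.
  by have /setP/(_ B) := e; rewrite !inE BF !andbT.
rewrite -(card_in_imset inj) (imset_comp (fun B => B :&: F) (@star T)).
have xp : 0 < #|F|%:R^-1 :> R by rewrite invr_gt0.
apply: le_trans (sauer_trace xp x1 (D := d) _) _; first exact: vc.
have xp' := ltW xp; have m0' := ltW m0.
rewrite -exprVn invrK mulrC ler_wpM2r ?exprn_ge0 //.
apply: le_trans (expr1D_le_expR _ xp') _.
by rewrite mulVf ?gt_eqF.
Qed.

Definition sep_rows (T : finType) (B B' : {set T}) := (B :\: B') :|: (B' :\: B).

(* Enough rows [V] of [A] separate all columns; Sauer-Shelah on [V] for the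
   columns with parameter [x = eps / 4] then gives [m <= x^-D * exp (x #|V|)]
   with the last factor of order [sqrt m]. *)
Lemma card_columns_le (R : realType) (T : finType) (F : {set {set T}})
    (A : {set T}) (d : nat) (eps : R) :
  0 < eps -> eps <= 1 -> (0 < #|A|)%N -> (0 < #|F|)%N -> row_vc_le F A d ->
  {in F &, forall B B', B != B' -> eps * #|A|%:R <= #|sep_rows B B' :&: A|%:R} ->
  #|F|%:R <= expR 1 * (4 / eps) ^+ (2 * (2 ^ d.+1).-1).
Proof.
move=> e0 e1 A0 F0 vc far.
have m0 : (0 < #|F|%:R :> R) by rewrite ltr0n.
have m1 : (1 <= #|F|%:R :> R) by rewrite ler1n.
pose P := [set p in finset.setX F F | p.1 != p.2].
pose hit (p : {set T} * {set T}) := sep_rows p.1 p.2.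
have ln0 : 0 <= ln #|F|%:R :> R by exact: ln_ge0.
have e0' := ltW e0; have m0' := ltW m0.
have x0 : 0 < eps / 4 by lra.
have x1 : eps / 4 <= 1 by lra.
have x0' := ltW x0.
(* Let [m = |F|]. For [k > q] the factor [(1 - eps)^k <= exp(- eps k)] is below [m^-2], so fewer
   than one of the at most [m^2] pairs stays unseparated. *)
pose q := 2 * ln #|F|%:R / eps.
have q0 : 0 <= q by rewrite /q mulr_ge0 ?invr_ge0 ?mulr_ge0.
have [k kq qk] : exists2 k : nat, k%:R <= q + 1 & q < k%:R.
  exists (Num.truncn q).+1; have /andP[h1 h2] := truncn_itv q0 => //.
  by rewrite -natr1 lerD2r.
have [p|V [VA Vk]] := @hitting_set R T _ A P hit eps e1 A0 _ k.
  rewrite !inE => /andP[/andP[pF pF'] ne]; exact: far.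
set Q := [set p in P | _] => bQ.
have Q0 : Q = set0.
  apply/eqP; rewrite -cards_eq0 -leqn0 -ltnS -(ltr_nat R); apply: le_lt_trans bQ _.
  have le : #|P|%:R <= #|F|%:R ^+ 2 :> R.
    rewrite -natrX ler_nat expnS expn1 -cardsX; apply: subset_leq_card.
    by apply/subsetP => p; rewrite inE => /andP[].
  apply: le_lt_trans (_ : expR (- (eps * k%:R)) * #|F|%:R ^+ 2 < _).
    apply: ler_pM => //; first by rewrite exprn_ge0 //; lra.
    rewrite -mulNr expRM_natr; apply: lerXn2r; rewrite ?nnegrE ?expR_ge0 //.
      by lra.
    exact: expR_ge1Dx.
  have lt : 2%:R * ln #|F|%:R < eps * k%:R.
    by move: qk; rewrite /q ltr_pdivrMr // (mulrC eps).
  rewrite expRN mulrC ltr_pdivrMr ?expR_gt0 // mul1r.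
  by rewrite -[X in X ^+ 2]lnK ?posrE // -expRM_natl ltr_expR.
have inj : {in F &, injective (fun B => B :&: V)}.
  move=> B B' BF B'F e; apply/eqP/negPn/negP => ne.
  suff : (B, B') \in Q by rewrite Q0 inE.
  rewrite !inE BF B'F ne /= -setI_eq0; apply/eqP/setP => a.
  have /setP/(_ a) := e; rewrite !inE.
  by case: (a \in V); rewrite ?andbF ?andbT // => ->; rewrite andNb.
set D := (2 ^ d.+1).-1.
have bF : #|F|%:R <= (eps / 4) ^- D * (1 + eps / 4) ^+ #|V|.
  rewrite -(card_in_imset inj); apply: sauer_trace => // S SV shS.
  rewrite -ltnS prednK ?expn_gt0 // ltnNge; apply/negP => big.
  have [Y [YF cY shY]] := dual_shatters shS big.
  suff : (#|Y| <= d)%N by rewrite cY ltnn.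
  by apply: vc YF _; apply: shatters_sub shY; apply: imsetS; apply: fintype.subset_trans SV VA.
have {}bF : #|F|%:R <= (eps / 4) ^- D * expR (eps / 4 * k%:R).
  apply: le_trans bF _; rewrite ler_wpM2l ?invr_ge0 ?exprn_ge0 //.
  apply: le_trans (_ : (1 + eps / 4) ^+ k <= _); first by rewrite ler_weXn2l //; lra.
  by apply: expr1D_le_expR; lra.
have xk : 2%:R * (eps / 4 * k%:R) <= ln #|F|%:R + 1.
  have : eps * k%:R <= eps * (q + 1) by rewrite ler_wpM2l.
  rewrite mulrDr /q [eps * (_ / _)]mulrC divfK ?gt_eqF //; lra.
(* Once squared, the exponential factor is at most [e m], and one factor [m] cancels. *)
have bF2 : #|F|%:R ^+ 2 <= (eps / 4) ^- (2 * D) * (#|F|%:R * expR 1).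
  apply: le_trans (_ : ((eps / 4) ^- D * expR (eps / 4 * k%:R)) ^+ 2 <= _).
    by apply: lerXn2r; rewrite ?nnegrE // mulr_ge0 ?expR_ge0 ?invr_ge0 ?exprn_ge0.
  rewrite exprMn -exprVn -exprM mulnC exprVn ler_wpM2l ?invr_ge0 ?exprn_ge0 //.
  by rewrite -expRM_natl -[X in X * expR 1]lnK ?posrE // -expRD ler_expR.
rewrite -(ler_pM2l m0) -expr2; apply: le_trans bF2 _.
by rewrite -exprVn invf_div mulrC mulrA.
Qed.

(** Combines the bounds on rows and columns: both factors [e] are absorbed by [e <= 4 / eps], and
    [2 (2^(d+1) - 1) + 2 = 2^(d+2)] gives the exponent. *)
Lemma card_far_columns_le (R : realType) (T : finType) (F : {set {set T}})
    (A : {set T}) (d : nat) (eps : R) :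
  0 < eps -> eps <= 1 -> (0 < d)%N -> (0 < #|A|)%N -> (0 < #|F|)%N ->
  separates F A -> row_vc_le F A d ->
  {in F &, forall B B', B != B' -> eps * #|A|%:R <= #|sep_rows B B' :&: A|%:R} ->
  #|A|%:R <= (4 / eps) ^+ (d * 2 ^ (d + 2)).
Proof.
move=> e0 e1 d0 A0 F0 sep vc far.
have bA := card_rows_le R sep vc F0.
have bF := card_columns_le e0 e1 A0 F0 vc far.
have e4 : expR 1 <= 4 / eps.
  apply: le_trans (expR1_le4 R) _; rewrite ler_pdivlMr //; lra.
have y0 : 0 <= 4 / eps by rewrite divr_ge0 // ltW.
apply: le_trans bA _.
apply: le_trans (_ : (4 / eps * (4 / eps * (4 / eps) ^+ (2 * (2 ^ d.+1).-1))) ^+ d <= _).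
  rewrite exprMn; apply: ler_pM; rewrite ?expR_ge0 ?exprn_ge0 //.
    apply: (le_trans e4); rewrite -[X in X <= _]expr1 ler_weXn2l //.
    by apply: le_trans e4; apply: le_trans (expR_ge1Dx _); rewrite lerDl.
  apply: lerXn2r; rewrite ?nnegrE //; first by rewrite mulr_ge0 ?exprn_ge0.
  by apply: le_trans bF _; rewrite ler_wpM2r // exprn_ge0.
rewrite -!exprS -exprM.
have -> : (2 * (2 ^ d.+1).-1).+2 = (2 ^ (d + 2))%N.
  by rewrite -[LHS]/(2 + _)%N -mulnS prednK ?expn_gt0 // -expnS addn2.
by rewrite mulnC.
Qed.

(** Contrapositive of the packing bound. Distinct columns of [F] may coincide on [A], so the bound
    is applied to one representative of each trace on [A]. *)
Lemma close_columns (R : realType) (T : finType) (F : {set {set T}})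
    (A : {set T}) (d : nat) (eps : R) :
  0 < eps -> eps <= 1 -> (0 < d)%N -> (1 < #|A|)%N ->
  separates F A -> row_vc_le F A d -> (4 / eps) ^+ (d * 2 ^ (d + 2)) < #|A|%:R ->
  exists B B' : {set T}, [/\ B \in F, B' \in F,
    A :&: (B :\: B') != set0 & #|A :&: (B :\: B')|%:R <= eps * #|A|%:R].
Proof.
move=> e0 e1 d0 A1 sep vc; rewrite ltNge => /negP big.
(* For [B \in F] the default is never taken, so [rep B] depends only on [B :&: A]. *)
pose rep (B : {set T}) : {set T} :=
  odflt B [pick B' : {set T} | (B' \in F) && (B' :&: A == B :&: A)].
have repP B : B \in F -> (rep B \in F) /\ rep B :&: A = B :&: A.
  rewrite /rep => BF; case: pickP => [B' /andP[B'F /eqP e]|/(_ B)]; first by split.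
  by rewrite BF eqxx.
have repE (B B' : {set T}) : B \in F -> B :&: A = B' :&: A -> rep B = rep B'.
  move=> BF e; rewrite /rep e; case: pickP => [//|/(_ B)].
  by rewrite BF e eqxx.
pose F' := [set rep B | B in F].
have F'F : F' \subset F.
  by apply/subsetP => _ /imsetP[B BF ->]; case: (repP B BF).
have sep' : separates F' A.
  move=> a b aA bA e; apply: sep => // B BF.
  have [_ /setP rB] := repP B BF; have := e _ (imset_f rep BF).
  by have := rB a; have := rB b; rewrite !inE aA bA !andbT => -> ->.
have F'0 : (0 < #|F'|)%N.
  rewrite lt0n; apply/negP; rewrite cards_eq0 => /eqP F'0.
  have /card_gt1P[a [b [aA bA /eqP ab]]] := A1.
  by apply: ab; apply: sep' => // B; rewrite F'0 inE.
apply: contrapT => no; apply: big.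
apply: (card_far_columns_le e0 e1 d0 (ltnW A1) F'0 sep').
  exact: row_vc_le_sub vc.
move=> B B' BF' B'F' ne; rewrite leNgt; apply/negP => lt; apply: no.
have BF := subsetP F'F _ BF'; have B'F := subsetP F'F _ B'F'.
(* A row of [A] in which the two columns differ decides their order, so that the one-sided
   difference is nonempty. *)
have [a aA Ba] : exists2 a, a \in A & (a \in B) != (a \in B').
  apply: contrapT => no; move/eqP: ne; apply.
  have /imsetP[C CF eC] := BF'; have /imsetP[C' C'F eC'] := B'F'.
  rewrite eC eC'; apply: repE => //.
  have [_ <-] := repP _ CF; have [_ <-] := repP _ C'F; rewrite -eC -eC'.
  apply/setP => a; rewrite !inE; have [aA|] := boolP (a \in A); rewrite ?andbF ?andbT //.
  by apply: contrapT => /eqP ne; apply: no; exists a.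
have le (D : {set T}) : D \subset sep_rows B B' :&: A -> #|D|%:R <= eps * #|A|%:R.
  by move=> sD; apply: le_trans (ltW lt); rewrite ler_nat subset_leq_card.
have [aB|aB] := boolP (a \in B).
  exists B, B'; split => //.
    by apply/set0Pn; exists a; rewrite !inE aA aB; move: Ba; rewrite aB; case: (a \in B').
  by apply: le; rewrite finset.setIC finset.setSI // finset.subsetUl.
exists B', B; split => //.
  by apply/set0Pn; exists a; rewrite !inE aA aB; move: Ba; rewrite (negbTE aB); case: (a \in B').
by apply: le; rewrite finset.setIC finset.setSI // finset.subsetUr.
Qed.

(** * Teaching sets by restriction and halving *)

Definition teaches (T : finType) (A : {set T}) (Y : {set {set T}}) (a : T) : Prop :=
  forall b, b \in A -> (forall B, B \in Y -> (b \in B) = (a \in B)) -> b = a.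

(** The values 1 at [B] and 0 at [B'] already force a row of [A] into the subclass. *)
Lemma teaches_split (T : finType) (A : {set T}) (Y : {set {set T}}) (B B' : {set T}) a :
  a \in A :&: (B :\: B') -> teaches (A :&: (B :\: B')) Y a ->
  teaches A (B |: (B' |: Y)) a.
Proof.
move=> aA tY b bA e; apply: tY => [|C CY]; last by apply: e; rewrite !inE CY !orbT.
move: aA; rewrite !inE bA => /and3P[_ aB' aB].
by rewrite !e ?aB ?aB' // !inE eqxx ?orbT.
Qed.

(** A column on which two rows differ cuts [A] into two nonempty parts; keeping the smaller one
    costs one point and at least halves the class. *)
Lemma exists_teaches_log (T : finType) (F : {set {set T}}) (A : {set T}) :
  separates F A -> (0 < #|A|)%N ->
  exists2 a, a \in A &
  exists Y : {set {set T}}, [/\ Y \subset F, (2 ^ #|Y| <= #|A|)%N & teaches A Y a].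
Proof.
have [n] := ubnP #|A|; elim: n A => // n IH A An sep A0.
have [A1|A1] := leqP #|A| 1.
  have /eqP/cards1P[a Aa] : #|A| = 1%N by apply/eqP; rewrite eqn_leq A1.
  exists a; first by rewrite Aa !inE.
  exists set0; rewrite sub0set cards0; split=> // b.
  by rewrite Aa !inE => /eqP.
have /card_gt1P[a [b [aA bA /eqP ab]]] := A1.
have [B BF neB] : exists2 B, B \in F & (a \in B) != (b \in B).
  apply: contrapT => no; apply: ab; apply: sep => // B BF.
  by apply: contrapT => /eqP ne; apply: no; exists B.
have cA : (#|A :&: B| + #|A :\: B| = #|A|)%N by rewrite cardsID.
have I0 : (0 < #|A :&: B|)%N.
  apply/card_gt0P; move: neB; case: (boolP (a \in B)) => [aB _|_ bB].
    by exists a; rewrite inE aA.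
  by exists b; rewrite inE bA; case: (b \in B) bB.
have D0 : (0 < #|A :\: B|)%N.
  apply/card_gt0P; move: neB; case: (boolP (a \in B)) => [aB bB|aB _].
    by exists b; rewrite inE bA; case: (b \in B) bB.
  by exists a; rewrite inE aA aB.
have [A' [A'A A'0 A'h A'B]] : exists A' : {set T}, [/\ A' \subset A, (0 < #|A'|)%N,
    (2 * #|A'| <= #|A|)%N & forall u v, u \in A' -> v \in A -> (v \in B) = (u \in B) -> v \in A'].
  have [h|h] := leqP #|A :&: B| #|A :\: B|.
    exists (A :&: B); split; rewrite ?finset.subsetIl //; first by lia.
    by move=> u v; rewrite !inE => /andP[_ uB] -> ->.
  exists (A :\: B); split; rewrite ?subsetDl //; first by lia.
  by move=> u v; rewrite !inE => /andP[uB _] -> ->; rewrite uB.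
have [|||u uA' [Y [YF Yc tY]]] := IH A' => //; first by lia.
  by move=> x y /(subsetP A'A) xA /(subsetP A'A) yA; exact: sep.
exists u; first exact: (subsetP A'A).
exists (B |: Y); split.
- by rewrite subUset sub1set BF.
- apply: leq_trans A'h; rewrite cardsU1; case: (B \notin Y); rewrite ?add1n ?add0n ?expnS; lia.
move=> v vA e; apply: tY => [|C CY]; last by apply: e; rewrite inE CY orbT.
by apply: A'B uA' vA _; apply: e; rewrite !inE eqxx.
Qed.

(** * Numerical estimates for logarithms *)

Lemma ln2_bounds (R : realType) : 0 < ln 2 :> R /\ ln 2 <= 3 / 4 :> R.
Proof.
split; first by apply: ln_gt0; lra.
rewrite -ler_expR lnK ?posrE //.
(* The upper bound rests on [2 <= (1 + 3/32)^8 <= exp(3/4)]. *)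
have h : 1 + 3 / 32 <= expR (3 / 32) :> R by exact: expR_ge1Dx.
have -> : 3 / 4 = 8%:R * (3 / 32) :> R by field.
rewrite expRM_natl.
apply: le_trans (_ : (1 + 3 / 32) ^+ 8 <= _); first by rewrite !exprS !expr0; lra.
by apply: lerXn2r h; rewrite nnegrE ?expR_ge0 //; lra.
Qed.

Lemma log2_le (R : realType) (x y : R) : 0 < x -> x <= y -> log2 x <= log2 y.
Proof.
move=> x0 xy; have [l0 _] := ln2_bounds R.
by rewrite /log2 ler_pM2r ?invr_gt0 // ler_ln ?posrE // (lt_le_trans x0).
Qed.

Lemma log2_exp2 (R : realType) n : log2 (2 ^+ n : R) = n%:R.
Proof.
have [l0 _] := ln2_bounds R.
by rewrite /log2 lnXn // -(mulr_natl (ln 2) n) mulfK ?gt_eqF.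
Qed.

Lemma log2M (R : realType) (x y : R) : 0 < x -> 0 < y -> log2 (x * y) = log2 x + log2 y.
Proof. by move=> x0 y0; rewrite /log2 lnM ?posrE // mulrDl. Qed.

Lemma log2_nat_ge (R : realType) (n m : nat) : (2 ^ n <= m)%N -> n%:R <= log2 m%:R :> R.
Proof.
move=> h; rewrite -(log2_exp2 R n); apply: log2_le; first by rewrite exprn_gt0.
by rewrite -natrX ler_nat.
Qed.

Lemma log2_4e2_ge4 (R : realType) : 4 <= log2 (4 * expR 1 ^+ 2) :> R.
Proof.
rewrite -[X in X <= _](log2_exp2 R 4); apply: log2_le; first by rewrite exprn_gt0.
have := @expR_ge1Dx R 1; move: (expR 1) => e e2.
have : 2 * 2 <= e * e by apply: ler_pM => //; lra.
rewrite !exprS !expr0; lra.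
Qed.

(** Bootstrapping: [L > K a >= 64] gives [log2 L >= 6], and then [L > K (4 + 6)]. *)
Lemma log2_ge_10 (R : realType) (K a L : R) :
  16 <= K -> 4 <= a -> 1 <= L -> K * (a + log2 L) < L -> 10 * K <= L.
Proof.
move=> K16 a4 L1 big.
have l0 : 0 <= log2 L by rewrite -[X in X <= _](log2_exp2 R 0) log2_le // expr0.
have L64 : 2 ^+ 6 <= L.
  rewrite !exprS expr0; nra.
have l6 : 6 <= log2 L by rewrite -[X in X <= _](log2_exp2 R 6) log2_le // exprn_gt0.
nra.
Qed.

(** Since [5 / L <= 1 / (2 K)], the ratio [L' / L] is at most [1 - 3 / (2 K)]. Then [ln t <= t - 1]
    and [ln 2 <= 3/4] make [log2] drop by at least [2 / K]. *)
Lemma bound_descent (R : realType) (K a L L' : R) :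
  16 <= K -> 1 <= L' -> 10 * K <= L -> L' <= L - 2 * (L / K) + 5 ->
  K * (a + log2 L') + 2 <= K * (a + log2 L).
Proof.
move=> K16 L'1 LK le.
have [l0 l1] := ln2_bounds R.
have K0 : 0 < K by lra. have L0 : 0 < L by lra. have L'0 : 0 < L' by lra.
have q : L' / L - 1 <= - (3 / 2 / K).
  rewrite lerBlDr ler_pdivrMr // mulrDl mul1r.
  have e : L / K = K^-1 * L by rewrite mulrC.
  have : K^-1 * (10 * K) <= K^-1 * L by rewrite ler_wpM2l // invr_ge0 ltW.
  rewrite mulrCA mulVf ?gt_eqF // => h.
  move: le; rewrite e => le.
  have -> : - (3 / 2 / K) * L = - (3 / 2) * (K^-1 * L) by field; lra.
  lra.
have ln : ln L' - ln L <= - (3 / 2 / K).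
  rewrite -ln_div ?posrE //; apply: le_trans q.
  rewrite -ler_expR lnK ?posrE ?divr_gt0 //.
  by apply: le_trans (expR_ge1Dx _); lra.
have : log2 L' - log2 L <= - 2 / K.
  rewrite /log2 -mulrBl ler_pdivrMr //; apply: (le_trans ln).
  have iK : 0 < K^-1 by rewrite invr_gt0.
  have -> : - 2 / K * exp.ln 2 = K^-1 * (- 2 * exp.ln 2) by field; lra.
  have -> : - (3 / 2 / K) = K^-1 * (- (3 / 2)) by field; lra.
  rewrite ler_pM2l //; lra.
rewrite ler_pdivlMr // => h; lra.
Qed.

(** * Induction on the number of concepts *)

Lemma exists_small_split (R : realType) (T : finType) (F : {set {set T}})
    (A : {set T}) (d : nat) :
  (0 < d)%N -> (1 < #|A|)%N -> separates F A -> row_vc_le F A d ->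
  let K := d%:R * 2 ^+ (d + 3) : R in
  10 * K <= log2 #|A|%:R ->
  exists B B' : {set T}, [/\ B \in F, B' \in F, A :&: (B :\: B') != set0 &
    log2 #|A :&: (B :\: B')|%:R <= log2 #|A|%:R - 2 * (log2 #|A|%:R / K) + 5].
Proof.
move=> d0 A1 sep vc K big.
have [l0 _] := ln2_bounds R.
have N0 : 0 < #|A|%:R :> R by rewrite ltr0n ltnW.
pose E := (d * 2 ^ (d + 2))%N.
have E0 : (0 < E)%N by rewrite muln_gt0 d0 expn_gt0.
have E0' : 0 < E%:R :> R by rewrite ltr0n.
have KE : K = 2 * E%:R.
  by rewrite /K /E natrM natrX (addnS d 2) exprS mulrCA.
pose r : R := ln #|A|%:R / E%:R.
(* Needed for [eps <= 1]. *)
have r5 : 5%:R * ln 2 <= r.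
  rewrite /r ler_pdivlMr //.
  move: big; rewrite /log2 ler_pdivlMr // KE; nra.
(* With [N = #|A|] and [K = 2 E], [log2 eps] equals [5 - 2 (log2 N / K)], the shift in the
   conclusion. *)
pose eps : R := 2 ^+ 5 * expR (- r).
have e0 : 0 < eps by rewrite mulr_gt0 ?exprn_gt0 ?expR_gt0.
have e1 : eps <= 1.
  rewrite /eps -[X in X ^+ 5]lnK ?posrE // -expRM_natl -expRD.
  by rewrite -[X in _ <= X]expR0 ler_expR; lra.
(* The left side is [N / 8^E], and [E] is positive. *)
have bE : (4 / eps) ^+ E < #|A|%:R.
  have -> : 4 / eps = expR r / 8.
    rewrite /eps expRN; have := expR_gt0 r => h.
    by field; rewrite gt_eqF.
  rewrite expr_div_n -expRM_natr /r divfK ?gt_eqF // lnK ?posrE //.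
  rewrite ltr_pdivrMr ?exprn_gt0 // ltr_pMr // exprn_egt1 -?lt0n //.
  by rewrite ltr1n.
have [B [B' [BF B'F ne le]]] := close_columns e0 e1 d0 A1 sep vc bE.
exists B, B'; split => //.
have A'0 : 0 < #|A :&: (B :\: B')|%:R :> R by rewrite ltr0n card_gt0.
apply: le_trans (log2_le A'0 le) _.
rewrite log2M // /eps log2M ?exprn_gt0 ?expR_gt0 // log2_exp2.
rewrite {1}/log2 expRK /r KE.
suff -> : - (ln #|A|%:R / E%:R) / ln 2 = - (2 * (log2 #|A|%:R / (2 * E%:R))) :> R by lra.
by rewrite /log2; field; rewrite !gt_eqF.
Qed.

(** Only the rows shrink in the induction; the points [F] stay, so both hypotheses on [A] pass to
    the subclass. *)
Lemma exists_teaches_bound (R : realType) (T : finType) (F : {set {set T}}) (d : nat)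
    (A : {set T}) :
  (0 < d)%N -> separates F A -> row_vc_le F A d -> (1 < #|A|)%N ->
  exists2 a, a \in A & exists Y : {set {set T}}, [/\ Y \subset F, teaches A Y a &
    #|Y|%:R <= d%:R * 2 ^+ (d + 3) *
      (log2 (4 * expR 1 ^+ 2) + log2 (log2 #|A|%:R)) :> R].
Proof.
move=> d0; set K : R := _ * _ ^+ _; set c : R := log2 (_ * _).
have c4 : 4 <= c by exact: log2_4e2_ge4.
have K16 : 16 <= K.
  apply: le_trans (_ : 1 * 2 ^+ 4 <= _); first by rewrite !exprS !expr0; lra.
  apply: ler_pM; rewrite ?exprn_ge0 ?ler1n //.
  by rewrite ler_weXn2l ?ler1n //; lia.
have [n] := ubnP #|A|; elim: n A => // n IH A An sep vc A1.
have L1 : 1 <= log2 #|A|%:R :> R by exact: (@log2_nat_ge R 1).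
have l0 : 0 <= log2 (log2 #|A|%:R) :> R.
  by rewrite -[X in X <= _](log2_exp2 R 0) log2_le ?expr0 // ltr01.
have [small|big] := leP (log2 #|A|%:R) (K * (c + log2 (log2 #|A|%:R))).
  have [a aA [Y [YF cY tY]]] := exists_teaches_log sep (ltnW A1).
  exists a => //; exists Y; split => //; apply: le_trans small.
  exact: log2_nat_ge.
have LK := log2_ge_10 K16 c4 L1 big.
have [B [B' [BF B'F ne le]]] := exists_small_split d0 A1 sep vc LK.
set A' := A :&: (B :\: B') in ne le.
have A'A : A' \subset A by exact: finset.subsetIl.
have sep' : separates F A'.
  by move=> x y /(subsetP A'A) xA /(subsetP A'A) yA; exact: sep.
have vc' : row_vc_le F A' d by exact: row_vc_le_sub vc.
have cY2 (Y : {set {set T}}) : #|B |: (B' |: Y)|%:R <= #|Y|%:R + 2 :> R.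
  rewrite -natrD ler_nat addnC !cardsU1 addnA leq_add2r.
  by case: (B \notin _); case: (B' \notin _).
have sY (Y : {set {set T}}) : Y \subset F -> B |: (B' |: Y) \subset F.
  by move=> YF; rewrite !subUset !sub1set BF B'F.
(* A single remaining row is taught by [B] and [B'] alone; the induction hypothesis needs at least
   two rows, which keeps the inner logarithm at least 1. *)
have [A'1|A'1] := leqP #|A'| 1.
  have /set0Pn[a aA'] := ne; exists a; first exact: (subsetP A'A).
  exists (B |: (B' |: set0)); split; first by apply: sY; rewrite sub0set.
    apply: teaches_split => // b bA' _.
    exact: (card_le1_eqP A'1).
  apply: le_trans (cY2 _) _; rewrite cards0; nra.
(* As [log2 |A| / K >= 10], the logarithm drops by at least 15. *)
have lt : (#|A'| < #|A|)%N.
  rewrite -(ltr_nat R); rewrite ltNge; apply/negP => ge.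
  have L'L : log2 #|A|%:R <= log2 #|A'|%:R :> R by apply: log2_le ge; rewrite ltr0n ltnW.
  have : 10 <= log2 #|A|%:R / K by rewrite ler_pdivlMr //; lra.
  have := le_trans L'L le; move: (log2 #|A|%:R / K) => t h1 h2; lra.
have [||a aA' [Y [YF tY cY]]] := IH A' _ sep' vc' => //; first by lia.
exists a; first exact: (subsetP A'A).
exists (B |: (B' |: Y)); split; [exact: sY|exact: teaches_split|].
apply: le_trans (cY2 _) _; apply: le_trans (_ : K * (c + log2 (log2 #|A'|%:R)) + 2 <= _).
  by rewrite lerD2r.
by apply: bound_descent => //; exact: (@log2_nat_ge R 1).
Qed.

(** A column in which two rows differ is by itself a shattered point. *)
Lemma row_vc_gt0 (T : finType) (F : {set {set T}}) (A : {set T}) (d : nat) :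
  separates F A -> row_vc_le F A d -> (1 < #|A|)%N -> (0 < d)%N.
Proof.
move=> sep vc /card_gt1P[a [b [aA bA /eqP ab]]].
have [B BF neB] : exists2 B, B \in F & (a \in B) != (b \in B).
  apply: contrapT => no; apply: ab; apply: sep => // B BF.
  by apply: contrapT => /eqP ne; apply: no; exists B.
rewrite -(cards1 B); apply: vc; first by rewrite sub1set.
move=> Z; rewrite subset1.
wlog aB : a b aA bA neB {ab} / a \in B => [wl|] ZB.
  have [aB|aB] := boolP (a \in B); first exact: wl aA bA neB aB ZB.
  have bB : b \in B by move: neB; rewrite (negbTE aB); case: (b \in B).
  by apply: wl bA aA _ bB ZB; rewrite eq_sym.
have bB : b \notin B by move: neB; rewrite aB; case: (b \in B).
case/orP: ZB => /eqP ->.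
  exists (star a); first exact: imset_f.
  by apply/setP => C; rewrite !inE; case: eqP => [->|]; rewrite ?andbF ?aB.
exists (star b); first exact: imset_f.
by apply/setP => C; rewrite !inE; case: eqP => [->|]; rewrite ?andbF ?(negbTE bB).
Qed.

(** * Transfer to concept classes over an arbitrary [X] *)

Local Open Scope classical_set_scope.
Local Open Scope card_scope.

Lemma nat_min_le (A : set nat) n : A n -> (nat_min A <= n)%N.
Proof. by rewrite /nat_min; case: xgetP => // k -> [_]; apply. Qed.

(** When there is no maximum the value is 0, which is where [0 <= b] enters. *)
Lemma nat_max_le (R : realType) (A : set nat) (b : R) :
  0 <= b -> (forall n, A n -> n%:R <= b) -> (nat_max A)%:R <= b.
Proof. by rewrite /nat_max => b0 h; case: xgetP => // k -> [/h]. Qed.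

Lemma card_eq_finset (T : finType) (S : {set T}) : [set` S] #= `I_#|S|.
Proof.
apply/card_set_bijP; exists (fun x => index x (enum S)); split.
- by move=> x /= xS; rewrite cardE index_mem mem_enum.
- move=> x y; rewrite !in_setE /= => xS yS e.
  by rewrite -(nth_index x (_ : x \in enum S)) ?mem_enum // e nth_index ?mem_enum.
- move=> n /= nS.
  have [x _] : exists x, x \in S by apply/card_gt0P; apply: leq_ltn_trans nS.
  exists (nth x (enum S) n) => /=; first by rewrite -mem_enum mem_nth -?cardE.
  by rewrite index_uniq ?enum_uniq -?cardE.
Qed.

Lemma card_image_finset (T : finType) (U : Type) (h : T -> U) (S : {set T}) :
  {in S &, injective h} -> [set h x | x in [set` S]] #= `I_#|S|.
Proof.
move=> inj; apply: card_eq_trans (card_eq_finset S); apply: inj_card_eq.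
by move=> x y; rewrite !in_setE /=; exact: inj.
Qed.

Lemma remaining_sub (X : Type) (C : set (X -> bool)) i : remaining C i `<=` C.
Proof. by elim: i => //= i IH c [/IH]. Qed.

Lemma teach_dim_min_le (X : Type) (D : set (X -> bool)) c Y n :
  D c -> teaching_set D c Y -> Y #= `I_n -> (teach_dim_min D <= n)%N.
Proof.
move=> Dc tY cY; apply: (@leq_trans (teach_dim D c)); apply: nat_min_le.
  by exists c.
by exists Y.
Qed.

Lemma finite_class_enum (X : Type) (C : set (X -> bool)) N :
  C #= `I_N -> exists2 f : 'I_N -> X -> bool, injective f & C = range f.
Proof.
move=> /card_set_bijP[g [gN gI gS]].
have /choice[f fP] (i : 'I_N) : exists c, C c /\ g c = i.
  by have [c Cc gc] := gS i (ltn_ord i); exists c.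
exists f => [i j e|].
  by apply: val_inj; rewrite /= -(fP i).2 -(fP j).2 e.
apply/seteqP; split => [c Cc|_ [i _ <-]]; last exact: (fP i).1.
exists (Ordinal (gN c Cc)) => //; apply: gI; rewrite ?in_setE //.
  exact: (fP _).1.
exact: (fP _).2.
Qed.

Definition column (N : nat) (X : Type) (f : 'I_N -> X -> bool) (x : X) : {set 'I_N} :=
  finset (fun i => f i x).

(** Identifies the points of [X] that no concept distinguishes; a possibly infinite [X] is thereby
    replaced by finitely many points. *)
Definition columns (N : nat) (X : Type) (f : 'I_N -> X -> bool) : {set {set 'I_N}} :=
  finset (fun B => `[< exists x, column f x = B >]).

Lemma columnP (N : nat) (X : Type) (f : 'I_N -> X -> bool) x : column f x \in columns f.
Proof. by rewrite finset.inE; apply/asboolP; exists x. Qed.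

(** Chooses a point for each column; [x0] serves the sets that are not columns. *)
Lemma columns_point (N : nat) (X : Type) (f : 'I_N -> X -> bool) (x0 : X) :
  exists pt, {in columns f, forall B, column f (pt B) = B}.
Proof.
have /choice[pt ptP] (B : {set 'I_N}) : exists x, B \in columns f -> column f x = B.
  have [|no] := boolP (B \in columns f); last by exists x0.
  by rewrite finset.inE => /asboolP[x <-]; exists x.
by exists pt => B; exact: ptP.
Qed.

Lemma columns_separate (N : nat) (X : Type) (f : 'I_N -> X -> bool) (A : {set 'I_N}) :
  injective f -> separates (columns f) A.
Proof.
move=> fI i j _ _ e; apply: fI; apply/funext => x.
by have := e _ (columnP f x); rewrite !finset.inE.
Qed.

(** The chosen points map a shattered set of columns injectively onto a shattered set of points. *)
Lemma columns_row_vc (N : nat) (X : Type) (f : 'I_N -> X -> bool) (x0 : X) (d : nat) :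
  has_VCdim (range f) d -> row_vc_le (columns f) finset.setT d.
Proof.
move=> [_ vc] Y YF sh; have [pt ptP] := columns_point f x0.
have ptI : {in Y &, injective pt}.
  by move=> B B' /(fintype.subsetP YF) BF /(fintype.subsetP YF) B'F e; rewrite -(ptP B) // e ptP.
have cY := card_image_finset ptI.
suff /vc : shattered (range f) [set pt B | B in [set` Y]].
  by rewrite (card_le_eql cY) card_le_II.
move=> Z ZY.
have [|_ /imsetP[i _ ->] /finset.setP e] := sh (finset (fun B => (B \in Y) && `[< Z (pt B) >])).
  by apply/fintype.subsetP => B; rewrite finset.inE => /andP[].
have h B : B \in Y -> f i (pt B) = `[< Z (pt B) >].
  move=> BY; have BF := fintype.subsetP YF B BY.
  have <- : (i \in B) = f i (pt B) by rewrite -{1}(ptP B BF) finset.inE.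
  by have := e B; rewrite !finset.inE BY andbT.
exists (f i); split; first by exists i.
  by move=> x Zx; have [B BY e'] := ZY x Zx; move: Zx; rewrite -e' h // => /asboolP.
by move=> _ [[B BY <-] nZ]; rewrite h //; apply/asboolP.
Qed.

Theorem mainTheorem2 (R : realType) (X : Type) (C : set (X -> bool))
    (N d : nat) (cardC : C #= `I_N) (N_ge2 : (2 <= N)%N)
    (vcC : has_VCdim C d) :
  (rec_teach_dim C)%:R <=
    d%:R * 2 ^+ (d + 3) *
      (log2 (4 * expR 1 ^+ 2) + log2 (log2 N%:R)) :> R.
Proof.
have [f fI eC] := finite_class_enum cardC.
have cT : #|(finset.setT : {set 'I_N})| = N by rewrite cardsT card_ord.
(* Over an empty [X] all concepts would coincide, but the indices 0 and 1 give different ones. *)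
have [x0] : exists x0 : X, True.
  apply: contrapT => no; have lt1 : (0 < N)%N by exact: ltnW.
  suff : Ordinal lt1 = Ordinal N_ge2 by [].
  by apply: fI; apply/funext => x; case: no; exists x.
move=> _.
have vc : row_vc_le (columns f) finset.setT d.
  by apply: columns_row_vc x0 _ _; rewrite -eC.
have sep A : separates (columns f) A by exact: columns_separate.
have d0 : (0 < d)%N by apply: row_vc_gt0 (sep finset.setT) vc _; rewrite cT.
have l0 n : (1 < n)%N -> 1 <= log2 n%:R :> R by move=> n1; exact: (@log2_nat_ge R 1).
have K0 : 0 <= d%:R * 2 ^+ (d + 3) :> R by rewrite mulr_ge0 ?exprn_ge0.
have ll0 : 0 <= log2 (4 * expR 1 ^+ 2) + log2 (log2 N%:R) :> R.
  rewrite addr_ge0 //; first by apply: le_trans (log2_4e2_ge4 R).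
  by rewrite -[X in X <= _](log2_exp2 R 0) log2_le ?expr0 ?ltr01 ?l0.
apply: nat_max_le => [|_ [i [c Dc] <-]]; first exact: mulr_ge0.
set D := remaining C i in Dc *.
have DC : D `<=` range f by rewrite -eC; exact: remaining_sub.
(* Every remaining class becomes a set of rows of the one enumeration [f]. *)
pose A : {set 'I_N} := finset (fun i => `[< D (f i) >]).
have [a0 _ fa0] := DC c Dc.
have a0A : a0 \in A by rewrite finset.inE; apply/asboolP; rewrite fa0.
have [pt ptP] := columns_point f x0.
(* Chosen points turn a teaching set of columns into one of points, of the same size. *)
have main a (Y : {set {set 'I_N}}) : a \in A -> Y \subset columns f -> teaches A Y a ->
    (teach_dim_min D <= #|Y|)%N.
  move=> aA /fintype.subsetP YF tY.
  have ptI : {in Y &, injective pt}.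
    by move=> B B' /YF BF /YF B'F e; rewrite -(ptP B) // e ptP.
  have Da : D (f a) by move: aA; rewrite finset.inE => /asboolP.
  apply: (teach_dim_min_le Da _ (card_image_finset ptI)).
  move=> c' Dc' ne e; apply: ne; have [j _ fj] := DC _ Dc'.
  rewrite -fj; congr f; apply: tY => [|B BY].
    by rewrite finset.inE; apply/asboolP; rewrite fj.
  have := e (pt B); rewrite -fj => h.
  by rewrite -(ptP B) ?YF // !finset.inE h //; exists B.
(* A lone concept is taught by the empty set, so this layer contributes 0. *)
have [A1|A1] := leqP #|A| 1.
  apply: le_trans (mulr_ge0 K0 ll0).
  have : (teach_dim_min D <= #|(finset.set0 : {set {set 'I_N}})|)%N.
    apply: (main a0 _ a0A (finset.sub0set _)) => b bA _.
    exact: (card_le1_eqP A1).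
  by rewrite cards0 leqn0 => /eqP ->.
have vcA : row_vc_le (columns f) A d.
  by apply: row_vc_le_sub vc => //; exact: finset.subsetT.
have [a aA [Y [YF tY cY]]] := exists_teaches_bound R d0 (sep A) vcA A1.
apply: le_trans (_ : #|Y|%:R <= _); first by rewrite ler_nat (main _ _ aA YF tY).
(* The bound is increasing in the class size, and [|A| <= N]. *)
apply: le_trans cY _; rewrite ler_wpM2l // lerD2l.
apply: log2_le; first by apply: lt_le_trans (l0 _ A1).
apply: log2_le; first by rewrite ltr0n ltnW.
by rewrite ler_nat; apply: leq_trans (max_card _) _; rewrite card_ord.
Qed.
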